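(* Let $d\ge 3$, let $K\subset\mathbb{E}^d$ be a convex body, and let $k$ be an integer with $2\le k\le d$. Suppose that there exists a sequence $(L_n)_{n\ge 1}$ of lines in $\mathbb{E}^d$, each of which is an axis of symmetry of $K$, such that: (i) the sequence contains infinitely many distinct lines; (ii) the affine hull of $\bigcup_{n} L_n$ has dimension $k$; (iii) if $i\neq j$, then $L_i$ is not perpendicular to $L_j$. Then, if $k\le d-1$, $K$ is a $k$-body of revolution; and if $k=d$, $K$ is a sphere.
   Context: $\mathbb{E}^d$ is $d$-dimensional Euclidean space. A convex body is a compact convex set with non-empty interior; ''$K$ is a sphere'' means that the convex body $K$ is a Euclidean ball. A $k$-flat is a $k$-dimensional affine subspace. Axis of symmetry: for a line $L\subset\mathbb{E}^d$, let $R_L$ be the isometry of $\mathbb{E}^d$ that fixes every point of $L$ and acts as $-I$ on the directions orthogonal to $L$ (so $R_L(q+w)=q-w$ for $q\in L$ and $w$ a vector orthogonal to $L$). The line $L$ is an axis of symmetry of $K$ if $R_L(K)=K$. $k$-body of revolution ($1\le k<d$): $K$ is a $k$-body of revolution if there exist a $k$-dimensional linear subspace $V$ and a $(d-k)$-flat $A$ orthogonal to $V$ (that is, a translate of $V^\perp$) such that for every $k$-flat $\Gamma$ parallel to $V$ with $\Gamma\cap K\neq\emptyset$, the set $K\cap\Gamma$ is a $k$-dimensional Euclidean ball (possibly degenerate to a single point) centered at the point $\Gamma\cap A$. *)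

(* Defs.v *)
From mathcomp Require Import all_boot all_order all_algebra.
From mathcomp Require Import all_classical all_reals all_analysis.
Import Order.TTheory GRing.Theory Num.Theory.
Import numFieldNormedType.Exports.

Set Implicit Arguments.
Unset Strict Implicit.
Unset Printing Implicit Defensive.

Local Open Scope classical_set_scope.
Local Open Scope ring_scope.

(* Euclidean space E^d is ['rV[R]_d] with the structure below.  The library
   puts the sup norm on ['rV[R]_d]; it induces the same topology, hence the
   same compact sets and interiors, but distances must use [enorm]. *)

Definition dotr (R : realType) (d : nat) (u v : 'rV[R]_d) : R :=
  \sum_(i < d) u 0 i * v 0 i.

Definition enorm (R : realType) (d : nat) (u : 'rV[R]_d) : R :=
  Num.sqrt (dotr u u).

Definition closed_eball (R : realType) (d : nat) (c : 'rV[R]_d) (r : R) :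
  set 'rV[R]_d := [set x | enorm (x - c) <= r].

Definition convex_body (R : realType) (d : nat) (K : set 'rV[R]_d) : Prop :=
  [/\ compact K, convex_set K & K° !=set0].

Definition is_sphere (R : realType) (d : nat) (K : set 'rV[R]_d) : Prop :=
  exists c r, 0 < r /\ K = closed_eball c r.

Definition flat (R : realType) (d : nat) (p : 'rV[R]_d)
  (V : {vspace 'rV[R]_d}) : set 'rV[R]_d := [set p + v | v in [set` V]].

Definition is_flat (R : realType) (d k : nat) (A : set 'rV[R]_d) : Prop :=
  exists p V, \dim V = k /\ A = flat p V.

Definition affine_hull (R : realType) (d : nat) (X : set 'rV[R]_d) :
  set 'rV[R]_d := smallest [set A | exists k, is_flat k A] X.

(* For a flat, the linear subspace it is parallel to. *)
Definition directions (R : realType) (d : nat) (A : set 'rV[R]_d) :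
  set 'rV[R]_d := [set p - q | p in A & q in A].

Definition orthogonal_sets (R : realType) (d : nat) (X Y : set 'rV[R]_d) :
  Prop := forall u v, X u -> Y v -> dotr u v = 0.

Definition perpendicular (R : realType) (d : nat) (L M : set 'rV[R]_d) : Prop :=
  orthogonal_sets (directions L) (directions M).

(* The map R_L : q + w |-> q - w for q in L and w orthogonal to L.  The
   decomposition x = q + w exists and is unique when L is a line, so the
   default value x of [xget] is then irrelevant; see [axial_symmetryE]. *)
Definition axial_symmetry (R : realType) (d : nat) (L : set 'rV[R]_d)
  (x : 'rV[R]_d) : 'rV[R]_d :=
  xget x [set y | exists q w, [/\ L q, orthogonal_sets [set w] (directions L),
                                  x = q + w & y = q - w]].

Definition axis_of_symmetry (R : realType) (d : nat) (K L : set 'rV[R]_d) :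
  Prop := is_flat 1 L /\ axial_symmetry L @` K = K.

(* Meaningful for 1 <= k < d.  The k-flats parallel to V are the [flat p V]. *)
Definition body_of_revolution (R : realType) (d k : nat) (K : set 'rV[R]_d) :
  Prop :=
  exists (V : {vspace 'rV[R]_d}) (A : set 'rV[R]_d),
    [/\ \dim V = k, is_flat (d - k) A, orthogonal_sets (directions A) [set` V] &
     forall p, flat p V `&` K !=set0 ->
       exists c r, [/\ 0 <= r, flat p V `&` A = [set c] &
                       K `&` flat p V = closed_eball c r `&` flat p V]].

Lemma dotrC (R : realType) (d : nat) (u v : 'rV[R]_d) : dotr u v = dotr v u.
Proof. by apply: eq_bigr => i _; rewrite mulrC. Qed.

Lemma dotrDl (R : realType) (d : nat) (u v w : 'rV[R]_d) :
  dotr (u + v) w = dotr u w + dotr v w.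
Proof. by rewrite -big_split/=; apply: eq_bigr => i _; rewrite mxE mulrDl. Qed.

Lemma dotrZl (R : realType) (d : nat) (a : R) (u v : 'rV[R]_d) :
  dotr (a *: u) v = a * dotr u v.
Proof. by rewrite mulr_sumr; apply: eq_bigr => i _; rewrite mxE mulrA. Qed.

Lemma dotrNl (R : realType) (d : nat) (u v : 'rV[R]_d) :
  dotr (- u) v = - dotr u v.
Proof. by rewrite -scaleN1r dotrZl mulN1r. Qed.

Lemma dotr_eq0 (R : realType) (d : nat) (u : 'rV[R]_d) :
  dotr u u = 0 -> u = 0.
Proof.
move=> /eqP; rewrite psumr_eq0 => [/allP u0|i _]; last by rewrite -expr2 sqr_ge0.
apply/rowP => i; rewrite mxE; apply/eqP.
by have := u0 i (mem_index_enum i); rewrite mulf_eq0 orbb.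
Qed.

Lemma axial_symmetryE (R : realType) (d : nat) (L : set 'rV[R]_d)
  (q w : 'rV[R]_d) :
  L q -> orthogonal_sets [set w] (directions L) ->
  axial_symmetry L (q + w) = q - w.
Proof.
move=> Lq wL; apply: xget_unique; first by exists q, w.
move=> _ [q' [w' [Lq' w'L e ->]]].
suff E : w' - w = 0.
  by move/eqP: E; rewrite subr_eq0 => /eqP E; move: e; rewrite E => /addIr ->.
have D : w' - w = q - q'.
  by apply/eqP; rewrite subr_eq addrAC e (addrC q') addrK.
have dL : directions L (w' - w) by rewrite D; exists q => //; exists q'.
by apply: dotr_eq0; rewrite dotrDl dotrNl w'L// wL// subrr.
Qed.

(* The decomposition x = q + w exists for every x, so [axial_symmetryE]
   determines [axial_symmetry L] everywhere. *)
Lemma line_decomposition (R : realType) (d : nat) (L : set 'rV[R]_d)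
  (x : 'rV[R]_d) : is_flat 1 L ->
  exists q w, [/\ L q, orthogonal_sets [set w] (directions L) & x = q + w].
Proof.
move=> [p [V [dV ->]]].
have [u u0 VE] : exists2 u : 'rV[R]_d, u != 0 & V = <[u]>%VS.
  exists (vpick V); first by rewrite vpick0 -dimv_eq0 dV.
  apply/eqP; rewrite eq_sym eqEdim -memvE memv_pick dV dim_vline vpick0.
  by rewrite -dimv_eq0 dV.
have uu : dotr u u != 0 by apply: contra_neq u0 => /dotr_eq0.
set a := dotr (x - p) u / dotr u u.
exists (p + a *: u), (x - p - a *: u); split.
- by exists (a *: u) => //=; rewrite VE memvZ// memv_line.
- move=> _ _ -> [_ [y /= Vy <-] [_ [z /= Vz <-] <-]].
  have : y - z \in V by rewrite memvB.
  rewrite VE => /vlineP[b yz].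
  rewrite (addrC p y) addrKA yz dotrC dotrZl dotrC dotrDl dotrNl dotrZl.
  by rewrite /a divfK// subrr mulr0.
- by rewrite -(addrA x) -opprD [RHS]addrC subrK.
Qed.

(* Main.v *)
Require Import Defs.
From mathcomp Require Import all_boot all_order all_algebra.
From mathcomp Require Import all_classical all_reals all_analysis.
From mathcomp Require Import ring lra zify.
Import Order.TTheory GRing.Theory Num.Theory numFieldNormedType.Exports.
Set Implicit Arguments.
Unset Strict Implicit.
Unset Printing Implicit Defensive.
Local Open Scope classical_set_scope.
Local Open Scope ring_scope.

(** An isometry preserving [K] fixes the centre [c] of its smallest enclosing
    ball with centre in [K], so all the axes pass through [c]
    ([axes_concurrent]). Take [c] as origin and let unit vectors [u n] span the
    axes. The claim becomes that [K] is invariant under all rotations of the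
    span of the [u n]: every section of [K] parallel to the span is then
    invariant under rotations about its point orthogonal to the span, and a
    compact convex set with this symmetry is a ball ([isotropic_section]).

    The product of the axial symmetries in two axes is a rotation, by twice the
    angle between them, in the plane that they span. Infinitely many axes
    accumulate, so there are such rotations by arbitrarily small nonzero angles,
    in planes converging to a plane [P]; as [K] is closed, it is invariant under
    all rotations of [P] ([exists_isotropic_plane]).

    This invariance then spreads. If [K] is invariant under the rotations of a
    subspace [W] of dimension at least [2], and an axis is neither in [W] nor
    orthogonal to it, then [K] is invariant under the rotations of the sum of
    [W] and that axis ([isotropic_add_line]). So if [W] contains a limit [a] of
    the [u n] and is maximal, each axis is in [W] or orthogonal to [W]; since no
    two axes are perpendicular the two cases do not mix, and the second cannot
    hold for all axes since [a] is in [W]. Hence [W] contains all the axes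
    ([isotropic_span]).

    Groups of rotations do not appear: invariance under the rotations of [W] is
    the condition [isotropic K W] on the points of [K], and passages to closed
    subgroups become extremal choices in compact sets. *)

Local Ltac rowring := apply/rowP => ?; rewrite !mxE; ring.

(** * The dot product and its topology *)

Section DotProduct.
Variables (R : realType) (d : nat).
Implicit Types (u v w x y : 'rV[R]_d) (V W : {vspace 'rV[R]_d}).

Lemma dotrDr u v w : dotr w (u + v) = dotr w u + dotr w v.
Proof. by rewrite dotrC dotrDl !(dotrC w). Qed.

Lemma dotrZr (a : R) u v : dotr u (a *: v) = a * dotr u v.
Proof. by rewrite dotrC dotrZl dotrC. Qed.

Lemma dotrNr u v : dotr u (- v) = - dotr u v.
Proof. by rewrite dotrC dotrNl dotrC. Qed.

Definition dotrE := (dotrDl, dotrDr, dotrZl, dotrZr, dotrNl, dotrNr).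

Lemma dotr0 u : dotr u 0 = 0.
Proof. by rewrite -(scale0r 0) dotrZr mul0r. Qed.

Lemma unit_neq0 u : dotr u u = 1 -> u != 0.
Proof.
by move=> u1; apply: contra_eq_neq u1 => ->; rewrite dotr0 eq_sym oner_neq0.
Qed.

Lemma dotr_ge0 u : 0 <= dotr u u.
Proof. by apply: sumr_ge0 => i _; rewrite -expr2 sqr_ge0. Qed.

Lemma dotr_gt0 u : u != 0 -> 0 < dotr u u.
Proof.
by move=> u0; rewrite lt0r dotr_ge0 andbT; apply: contra_neq u0 => /dotr_eq0.
Qed.

Lemma dotr_CauchySchwarz u v : dotr u v ^+ 2 <= dotr u u * dotr v v.
Proof.
have [->|v0] := eqVneq v 0; first by rewrite !dotr0 expr0n mulr0.
have vv := dotr_gt0 v0.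
have := dotr_ge0 (dotr v v *: u - dotr u v *: v).
rewrite !dotrE (dotrC v u).
set a := dotr u u; set b := dotr u v; set c := dotr v v in vv *.
rewrite (_ : _ + _ = c * (a * c - b ^+ 2)); last by ring.
by rewrite pmulr_rge0// subr_ge0.
Qed.

Lemma enorm_ge0 u : 0 <= enorm u.
Proof. exact: sqrtr_ge0. Qed.

Lemma sqr_enorm u : enorm u ^+ 2 = dotr u u.
Proof. by rewrite sqr_sqrtr// dotr_ge0. Qed.

Lemma enorm_le u (r : R) : 0 <= r -> (enorm u <= r) = (dotr u u <= r ^+ 2).
Proof.
by move=> r0; rewrite -sqr_enorm ler_pXn2r// ?nnegrE ?enorm_ge0.
Qed.

Lemma enormN u : enorm (- u) = enorm u.
Proof. by rewrite /enorm dotrNl dotrNr opprK. Qed.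

Lemma enormD u v : enorm (u + v) <= enorm u + enorm v.
Proof.
rewrite enorm_le ?addr_ge0 ?enorm_ge0// !dotrE (dotrC v u) sqrrD !sqr_enorm.
suff : dotr u v <= enorm u * enorm v by lra.
apply: le_trans (ler_norm _) _.
rewrite -(ler_pXn2r (ltn0Sn 1)) ?nnegrE ?mulr_ge0 ?enorm_ge0//.
by rewrite real_normK ?num_real// exprMn !sqr_enorm dotr_CauchySchwarz.
Qed.

Lemma unit_direction u : u != 0 ->
  exists (a : R) e, [/\ 0 < a, dotr e e = 1 & u = a *: e].
Proof.
move=> u0; have e0 : 0 < enorm u by rewrite sqrtr_gt0 dotr_gt0.
exists (enorm u), ((enorm u)^-1 *: u); split=> //.
  by rewrite !dotrE -sqr_enorm; field; exact: lt0r_neq0.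
by rewrite scalerA divff ?scale1r// lt0r_neq0.
Qed.

Lemma continuous_dotr (T : topologicalType) (f g : T -> 'rV[R]_d) :
  continuous f -> continuous g -> continuous (fun t => dotr (f t) (g t)).
Proof.
have coord (h : T -> 'rV[R]_d) i :
    continuous h -> continuous (fun t => h t 0 i).
  move=> hc t.
  apply: (@continuous_comp _ _ _ h (fun M => M 0 i)) => [|M].
    exact: hc.
  exact: coord_continuous.
move=> cf cg x; apply: cvg_big => [|i _]; first exact: add_continuous.
by apply: cvgM; exact: coord.
Qed.

Lemma closed_sphere (r : R) : closed [set v : 'rV[R]_d | dotr v v = r].
Proof.
have /continuous_closedP/(_ [set r]) cl :
    continuous (fun x : 'rV[R]_d => dotr x x).
  by apply: continuous_dotr => x; exact: cvg_id.
by apply: cl; exact: closed_eq.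
Qed.

Lemma closed_orthogonal w : closed [set v | dotr v w = 0].
Proof.
have /continuous_closedP/(_ [set 0]) cl :
    continuous (fun v : 'rV[R]_d => dotr v w).
  by apply: continuous_dotr => v; [exact: cvg_id|exact: cst_continuous].
by apply: cl; exact: closed_eq.
Qed.

Lemma unit_sphere_compact : compact [set x : 'rV[R]_d | dotr x x = 1].
Proof.
apply: bounded_closed_compact; last exact: closed_sphere.
exists 1; split; first exact: num_real.
move=> M M1 x /= xx; apply: le_trans (ltW M1).
change (mx_norm x <= 1).
have [->|/mx_norm_neq0[[j i] /= ->]] := eqVneq (mx_norm x) 0.
  exact: ler01.
rewrite ord1 -(ler_pXn2r (ltn0Sn 1)) ?nnegrE// real_normK ?num_real// expr1n.
rewrite -xx /dotr (bigD1 i)//= -expr2 lerDl.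
by apply: sumr_ge0 => k _; rewrite -expr2 sqr_ge0.
Qed.

(** Compactness of the sphere in the form used below: a cluster point stands in
    for the limit of a subsequence, without naming the subsequence. *)
Lemma unit_seq_cluster (v : nat -> 'rV[R]_d) :
  (forall n, dotr (v n) (v n) = 1) ->
  exists2 a, dotr a a = 1 &
    forall B N, nbhs a B -> exists2 n, (N <= n)%N & B (v n).
Proof.
move=> v1.
have [|a [a1 cla]] := @unit_sphere_compact (v @ \oo) _.
  by exists 0%N => // n _ /=.
exists a => // B N aB.
have [|_ [[n Nn <-] Bn]] := cla (v @` [set n | (N <= n)%N]) B _ aB.
  by exists N => // n Nn; exists n.
by exists n.
Qed.

Lemma cluster_closed (v : nat -> 'rV[R]_d) a (A : set 'rV[R]_d) :
  (forall B N, nbhs a B -> exists2 n, (N <= n)%N & B (v n)) ->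
  closed A -> (forall n, A (v n)) -> A a.
Proof.
by move=> cla + Av; apply=> B /(cla _ 0%N)[n _ Bn]; exists (v n).
Qed.

End DotProduct.

(** * Orthogonal complements *)

Section OrthogonalComplement.
Variables (R : realType) (d : nat).
Implicit Types (u v w x y : 'rV[R]_d) (V W : {vspace 'rV[R]_d}).

(** The coordinates are dot products with a basis of [V], so that the kernel is
    the orthogonal complement; being given by a matrix makes the map linear. *)
Definition dot_vbasis V : 'Hom('rV[R]_d, 'rV[R]_(\dim V)) :=
  linfun (mulmxr (\matrix_(i < d, j < \dim V) (vbasis V)`_j 0 i)).

Definition orthv V : {vspace 'rV[R]_d} := lker (dot_vbasis V).

Lemma orthvP V x : x \in orthv V <-> forall v, v \in V -> dotr x v = 0.
Proof.
rewrite memv_ker lfunE/=; split=> [/eqP xV v vV|xV].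
  rewrite (coord_vbasis vV) /dotr.
  under eq_bigr do rewrite summxE mulr_sumr.
  rewrite exchange_big big1//= => j _.
  have /rowP/(_ j) := xV; rewrite !mxE => xj.
  under eq_bigr do rewrite mxE mulrCA.
  rewrite -mulr_sumr (_ : \sum_i _ = 0) ?mulr0// -[RHS]xj.
  by apply: eq_bigr => i _; rewrite mxE.
apply/eqP/rowP => j; rewrite !mxE.
rewrite -[RHS](xV (vbasis V)`_j); last first.
  by rewrite vbasis_mem// mem_nth// size_tuple.
by apply: eq_bigr => i _; rewrite !mxE.
Qed.

Lemma orthv_cap V : (V :&: orthv V = 0)%VS.
Proof.
apply/eqP; rewrite -subv0; apply/subvP => x; rewrite memv_cap memv0.
by move=> /andP[xV /orthvP/(_ x xV)/dotr_eq0 ->].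
Qed.

Lemma dim_orthv V : \dim (orthv V) = (d - \dim V)%N.
Proof.
have := dimv_disjoint_sum (orthv_cap V).
have := limg_ker_dim (dot_vbasis V) fullv; rewrite capfv -/(orthv V).
have := dimvS (subvf (dot_vbasis V @: fullv)).
have := dimvS (subvf (V + orthv V)).
rewrite !dimvf /dim/= !mul1n; set n := \dim (orthv V).
by set m := \dim (limg _); set k := \dim V; lia.
Qed.

Lemma orthv_decomposition V x :
  exists v w, [/\ v \in V, w \in orthv V & x = v + w].
Proof.
have : x \in (V + orthv V)%VS.
  suff -> : (V + orthv V)%VS = fullv by exact: memvf.
  apply/eqP; rewrite eqEdim subvf/= dimv_disjoint_sum ?orthv_cap// dim_orthv.
  by rewrite dimvf /dim/= mul1n -maxnE leq_maxr.
by move=> /memv_addP[v vV [w wV ->]]; exists v, w.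
Qed.

Lemma orthogonal_in_dim2 V u : (2 <= \dim V)%N ->
  exists g, [/\ g \in V, dotr g g = 1 & dotr g u = 0].
Proof.
move=> dV; have : (V :&: orthv <[u]>)%VS != 0%VS.
  rewrite -dimv_eq0; have := dimv_sum_cap V (orthv <[u]>).
  have := dimvS (subvf (V + orthv <[u]>)).
  rewrite dim_orthv dim_vline dimvf /dim/= mul1n.
  have := dimvS (subvf V); rewrite dimvf /dim/= mul1n.
  by case: eqP; lia.
rewrite -vpick0; set g := vpick _ => g0.
have : g \in (V :&: orthv <[u]>)%VS by exact: memv_pick.
rewrite memv_cap => /andP[gV /orthvP gu].
have [a [e [a0 e1 ge]]] := unit_direction g0.
have eE : e = a^-1 *: g by rewrite ge scalerA mulVf ?scale1r// gt_eqF.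
exists e; split=> //; first by rewrite eE memvZ.
by rewrite eE dotrZl gu ?mulr0// memv_line.
Qed.

Lemma closed_flat x V : closed [set p | p - x \in V].
Proof.
have -> : [set p | p - x \in V] =
    \bigcap_(w in [set` orthv V]) [set p | dotr (p - x) w = 0].
  apply/seteqP; split=> p /=.
    by move=> pV w /= /orthvP wV; rewrite dotrC wV.
  move=> h; have [v [w [vV wV e]]] := orthv_decomposition V (p - x).
  have /= := h w wV; rewrite e dotrDl (dotrC v).
  by move/orthvP: (wV) => ->//; rewrite add0r => /dotr_eq0 ->; rewrite addr0.
apply: closed_bigI => w _.
have /continuous_closedP/(_ _ (@closed_orthogonal R d w)) :
    continuous (fun p : 'rV[R]_d => p - x); last exact.
by move=> p; apply: continuousB; [exact: cvg_id|exact: cst_continuous].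
Qed.
End OrthogonalComplement.

(** * Sets invariant under the rotations of a subspace *)

Section Isotropic.
Variables (R : realType) (d : nat).
Implicit Types (u v w x y : 'rV[R]_d) (V W : {vspace 'rV[R]_d}).
Implicit Types (K : set 'rV[R]_d).

(** The axial symmetry in the line spanned by a unit vector [u]. *)
Definition refl u x : 'rV[R]_d := (2 * dotr x u) *: u - x.

Definition refl_stable K u := forall x, K x -> K (refl u x).

(** For [2 <= \dim W] this is invariance of [K] under the rotations of [W]
    extended by the identity on its orthogonal complement: those rotations act
    transitively on each sphere of each flat parallel to [W] centred on that
    complement, and [y] ranges over the orbit of [x]. *)
Definition isotropic K W :=
  forall x y, K x -> y - x \in W -> dotr y y = dotr x x -> K y.

Lemma dotr_refl u x : dotr u u = 1 ->
  dotr (refl u x) (refl u x) = dotr x x.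
Proof. by move=> u1; rewrite /refl !dotrE u1 (dotrC u); ring. Qed.

(** Write [u = b *: f + a *: e] with unit vectors [f] in [W] and [e] orthogonal
    to [W]. On a sphere of a flat parallel to [W + <[u]>], isotropy along [W]
    means that only the height, i.e. the dot product with [e], matters. Let [h]
    be the height of a point of [K] on the sphere and [t] any other height
    occurring on it. With [c = 2 a^2 - 1] and [s = 2 a b], so that
    [c^2 + s^2 = 1], two applications of [refl u], each preceded by a move
    along [W], produce a point of [K] at height [c^2 h + s^2 t]: a proper
    contraction towards [t], since [s != 0]. As [K] is compact, some point of
    it minimises the distance to [t] in height; the contraction forces this
    minimum to be [0]. Two applications of [refl u] are needed because each one
    reverses the component orthogonal to [W + <[u]>]. *)
Lemma isotropic_add_line K W u : compact K -> isotropic K W ->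
  (2 <= \dim W)%N -> dotr u u = 1 -> refl_stable K u -> u \notin W ->
  (exists2 w, w \in W & dotr u w != 0) -> isotropic K (W + <[u]>).
Proof.
move=> cK isoW dW u1 Ku uW [w0 w0W uw0] x y Kx yxU yx.
have [uW1 [uW2 [uW1W /orthvP uW2W uE]]] := orthv_decomposition W u.
have [b [f [b0 f1 fE]]] :
    exists (b : R) f, [/\ 0 < b, dotr f f = 1 & uW1 = b *: f].
  apply: unit_direction; apply: contra_neq uw0 => u0.
  by rewrite uE u0 add0r uW2W.
have [a [e [a0 e1 eE]]] :
    exists (a : R) e, [/\ 0 < a, dotr e e = 1 & uW2 = a *: e].
  apply: unit_direction; apply: contraNneq uW => u0.
  by rewrite uE u0 addr0.
rewrite {}fE {}eE in uE uW1W uW2W.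
have fW : f \in W.
  suff -> : f = b^-1 *: (b *: f) by rewrite memvZ.
  by rewrite scalerA mulVf ?scale1r// gt_eqF.
have eW v : v \in W -> dotr e v = 0.
  move=> /uW2W/eqP; rewrite dotrZl mulf_eq0 gt_eqF//=; exact/eqP.
have [g [gW g1 gf]] := orthogonal_in_dim2 f dW.
have eU : e \in (W + <[u]>)%VS.
  have -> : e = a^-1 *: (- b *: f + u).
    rewrite uE scaleNr addKr scalerA mulVf ?scale1r// gt_eqF//.
  by rewrite memvZ// memv_add ?memvZ// memv_line.
have WU v : v \in W -> v \in (W + <[u]>)%VS by apply/subvP/addvSl.
have uU : u \in (W + <[u]>)%VS by apply: subvP (addvSr _ _) _ (memv_line _).
have fe : dotr f e = 0 by rewrite dotrC eW.
have ge : dotr g e = 0 by rewrite dotrC eW.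
have ab : a ^+ 2 + b ^+ 2 = 1.
  by rewrite -u1 uE !dotrE f1 e1 fe eW//; ring.
pose S := [set p | [/\ K p, p - x \in (W + <[u]>)%VS & dotr p p = dotr x x]].
have [p pS pmin] : exists2 p, p \in S &
    forall q, q \in S ->
      (dotr p e - dotr y e) ^+ 2 <= (dotr q e - dotr y e) ^+ 2.
  apply: (@compact_EVT_min _ R (fun p => (dotr p e - dotr y e) ^+ 2)).
  - by exists x; split=> //; rewrite subrr mem0v.
  - have -> : S = K `&` ([set p | p - x \in (W + <[u]>)%VS] `&`
                     [set p | dotr p p = dotr x x]).
      by apply/seteqP; split => q /=; [case|case=> ? []]; split.
    apply: compact_closedI cK _; apply: closedI; first exact: closed_flat.
    exact: closed_sphere.
  - apply: continuous_subspaceT => q.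
    have ce : continuous (fun p : 'rV[R]_d => dotr p e).
      by apply: continuous_dotr => r; [exact: cvg_id|exact: cst_continuous].
    have cB : {for q, continuous (fun p : 'rV[R]_d => dotr p e - dotr y e)}.
      by apply: continuousB; [exact: ce|exact: cst_continuous].
    exact: (@continuousM _ _ _ _ q cB cB).
move/set_mem: pS => [Kp pxU px].
have [w [w' [wW /orthvP w'W pE]]] := orthv_decomposition W p.
set h := dotr p e in pmin.
pose z := w' - h *: e.
have {}pE : p = w + h *: e + z by rewrite pE /z; rowring.
have zW v : v \in W -> dotr z v = 0.
  by move=> vW; rewrite !dotrE w'W// eW// mulr0 subr0.
have we : dotr w e = 0 by rewrite dotrC eW.
have hE : h = dotr w' e.
  have := congr1 (fun v => dotr v e) pE; rewrite /= -/h /z !dotrE we e1; lra.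
have ze : dotr z e = 0 by rewrite !dotrE e1 -hE mulr1 subrr.
clearbody z.
have [w1 w1W [_ /vlineP[l ->] ypE]] : exists2 w1, w1 \in W &
    exists2 v, v \in <[u]>%VS & y - p = w1 + v.
  apply/memv_addP; have -> : y - p = (y - x) - (p - x).
    by rewrite opprB addrA subrK.
  by rewrite memvB.
have yE : y = (w + w1 + (l * b) *: f) + (h + l * a) *: e + z.
  by rewrite -(subrK p y) ypE pE uE; rowring.
set t := dotr y e in pmin.
have tE : t = h + l * a.
  rewrite /t yE !dotrE we (dotrC w1) eW// fe e1 ze; ring.
pose c := 2 * a ^+ 2 - 1; pose s := 2 * a * b.
have cs : c ^+ 2 + s ^+ 2 = 1.
  have -> : c ^+ 2 + s ^+ 2 = 1 + 4 * a ^+ 2 * (a ^+ 2 + b ^+ 2 - 1).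
    by rewrite /c /s; ring.
  by rewrite ab subrr mulr0 addr0.
(* The height [t] does occur on the sphere through [p]. *)
have tt : t ^+ 2 <= dotr w w + h ^+ 2.
  have [v vW yv] : exists2 v, v \in W & y = v + t *: e + z.
    exists (w + w1 + (l * b) *: f); first by rewrite !memvD ?memvZ.
    by rewrite tE -yE.
  have : dotr y y = dotr p p by rewrite yx px.
  have := dotr_ge0 v; rewrite yv {1 2}pE !dotrE (dotrC v z) (dotrC w z).
  rewrite (zW v)// (zW w)// (dotrC v e) (eW v)// we (dotrC e w) we.
  by rewrite (dotrC e z) ze e1; lra.
pose m := enorm w; have mm : m ^+ 2 = dotr w w by rewrite sqr_enorm.
pose q := Num.sqrt (s ^+ 2 * h ^+ 2 + m ^+ 2 - s ^+ 2 * t ^+ 2).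
have qq : q ^+ 2 = s ^+ 2 * h ^+ 2 + m ^+ 2 - s ^+ 2 * t ^+ 2.
  rewrite sqr_sqrtr// mm.
  have : 0 <= s ^+ 2 * (dotr w w + h ^+ 2 - t ^+ 2).
    by rewrite mulr_ge0 ?sqr_ge0 ?subr_ge0.
  have : 0 <= (1 - s ^+ 2) * dotr w w.
    by rewrite mulr_ge0 ?dotr_ge0// -cs addrK sqr_ge0.
  lra.
(* First move along [W]: the component [w] of [p] is replaced by one of the
   same length orthogonal to [f]. *)
pose p1 := m *: g + h *: e + z.
have dots := (zW _ fW, zW _ gW, dotrC f z, dotrC g z, dotrC e z, dotrC e f,
  dotrC e g, dotrC f g, fe, ge, gf, f1, g1, e1, ze).
have p1p : dotr p1 p1 = dotr p p.
  rewrite /p1 {1 2}pE !dotrE !dots.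
  by rewrite (dotrC e w) we (dotrC w z) (zW w)// -mm; ring.
have Kp1 : K p1.
  apply: (isoW p) => //.
  have -> : p1 - p = m *: g - w by rewrite /p1 pE; rowring.
  by rewrite memvB// memvZ.
have Kr := Ku _ Kp1.
have p1u : dotr p1 u = h * a.
  by rewrite /p1 uE !dotrE !dots; ring.
(* Second move along [W], from [refl u p1]: its component along [W] becomes
   [(s * t) *: f + q *: g], where [q] is chosen to keep the length. *)
pose p3 := (s * t) *: f + q *: g + (c * h) *: e - z.
have p3p1 : dotr p3 p3 = dotr p1 p1.
  rewrite /p3 /p1 !dotrE !dots.
  transitivity (s ^+ 2 * t ^+ 2 + q ^+ 2 + c ^+ 2 * h ^+ 2 + dotr z z).
    by ring.
  transitivity (m ^+ 2 + h ^+ 2 * (c ^+ 2 + s ^+ 2) + dotr z z).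
    by rewrite qq; ring.
  by rewrite cs; ring.
have Kp3 : K p3.
  apply: (isoW (refl u p1)) => //.
    have -> : p3 - refl u p1 = (s * t - s * h) *: f + (q + m) *: g.
      by rewrite /p3 /refl p1u uE /p1 /c /s; rowring.
    by rewrite memvD// memvZ.
  by rewrite dotr_refl.
have Kp4 := Ku _ Kp3.
have p4S : refl u p3 \in S.
  apply/mem_set; split=> //.
    rewrite -(subrK p (refl u p3)) -addrA memvD//.
    have -> : refl u p3 - p = (2 * dotr p3 u) *: u
        - ((s * t) *: f + q *: g + w) - (c * h + h) *: e.
      by rewrite /refl {2}/p3 {1}pE; rowring.
    by rewrite !memvB ?memvZ// WU// !memvD ?memvZ.
  by rewrite dotr_refl// p3p1 p1p.
have p4e : dotr (refl u p3) e = s ^+ 2 * t + c ^+ 2 * h.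
  rewrite /refl !dotrE /p3 uE !dotrE !dots /c /s; ring.
have s0 : 0 < s ^+ 2 by rewrite exprn_gt0// !mulr_gt0.
have l0 : l = 0.
  have := pmin _ p4S; rewrite p4e.
  have -> : s ^+ 2 * t + c ^+ 2 * h - t =
      c ^+ 2 * (h - t) + (c ^+ 2 + s ^+ 2 - 1) * t.
    by ring.
  rewrite cs subrr mul0r addr0 exprMn -subr_le0 -[X in X - _]mul1r -mulrBl.
  rewrite pmulr_rle0; last first.
    have -> : 1 - c ^+ 2 ^+ 2 = (1 - c ^+ 2) * (1 + c ^+ 2) by ring.
    by rewrite -{1}cs addrC addKr mulr_gt0// ltr_wpDr ?sqr_ge0.
  rewrite real_exprn_even_le0 ?num_real//= tE opprD addNKr.
  by rewrite oppr_eq0 mulf_eq0 (gt_eqF a0) orbF => /eqP.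
apply: (isoW p) => //; first by rewrite ypE l0 scale0r addr0.
by rewrite yx px.
Qed.
End Isotropic.

(** * A plane of rotations from accumulating axes *)

Section Plane.
Variables (R : realType) (d : nat).
Implicit Types (a b u v w x y : 'rV[R]_d) (V W : {vspace 'rV[R]_d}).
Implicit Types (K : set 'rV[R]_d) (C S c s : R).

(** For orthonormal [a], [b] and [C^2 + S^2 = 1], the rotation of their plane by
    the angle with cosine [C] and sine [S], extended by the identity on the
    orthogonal complement. *)
Definition rot a b C S x : 'rV[R]_d :=
  x + ((C - 1) * dotr x a - S * dotr x b) *: a
    + (S * dotr x a + (C - 1) * dotr x b) *: b.

Definition orthonormal2 a b := [/\ dotr a a = 1, dotr b b = 1 & dotr a b = 0].

Lemma rot_comp a b c s C S x : orthonormal2 a b ->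
  rot a b c s (rot a b C S x) =
  rot a b (c * C - s * S) (s * C + c * S) x.
Proof.
case=> a1 b1 ab; have ba : dotr b a = 0 by rewrite dotrC.
rewrite /rot !dotrE a1 b1 ab ba; rowring.
Qed.

(** Composing two axial symmetries gives the rotation by twice the angle between
    the axes; the other order of composition reverses it. *)
Lemma refl_comp a b al be x : orthonormal2 a b -> al ^+ 2 + be ^+ 2 = 1 ->
  refl (al *: a + be *: b) (refl a x) =
  rot a b (al ^+ 2 - be ^+ 2) (2 * al * be) x.
Proof.
case=> a1 b1 ab e; rewrite /rot /refl !dotrE a1 ab.
apply/rowP => i; rewrite !mxE.
have be2 : be ^+ 2 = 1 - al ^+ 2 by rewrite -e addrAC subrr add0r.
ring: be2.
Qed.

Lemma refl_compV a b al be x : orthonormal2 a b -> al ^+ 2 + be ^+ 2 = 1 ->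
  refl a (refl (al *: a + be *: b) x) =
  rot a b (al ^+ 2 - be ^+ 2) (- (2 * al * be)) x.
Proof.
case=> a1 b1 ab e; have ba : dotr b a = 0 by rewrite dotrC.
rewrite /rot /refl !dotrE a1 ba.
apply/rowP => i; rewrite !mxE.
have be2 : be ^+ 2 = 1 - al ^+ 2 by rewrite -e addrAC subrr add0r.
ring: be2.
Qed.

Lemma continuous_rot (T : topologicalType) a (f : T -> 'rV[R]_d)
    (g h : T -> R) x :
  continuous f -> continuous g -> continuous h ->
  continuous (fun t => rot a (f t) (g t) (h t) x).
Proof.
move=> cf cg ch.
have cxf : continuous (fun t => dotr x (f t)).
  by apply: continuous_dotr => // t; exact: cst_continuous.
have cst (r : R) : continuous (fun _ : T => r) by exact: cst_continuous.
move=> t; apply: cvgD; first (apply: cvgD; first exact: cvg_cst).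
  apply: cvgZ; last exact: cvg_cst.
  apply: cvgB; last by apply: cvgM; [exact: ch|exact: cxf].
  apply: cvgM; last exact: cvg_cst.
  by apply: cvgB; [exact: cg|exact: cvg_cst].
apply: cvgZ; last exact: cf.
apply: cvgD; first by apply: cvgM; [exact: ch|exact: cvg_cst].
by apply: cvgM; [apply: cvgB; [exact: cg|exact: cvg_cst]|exact: cxf].
Qed.

Lemma circle_compact : compact [set z : R * R | z.1 ^+ 2 + z.2 ^+ 2 = 1].
Proof.
have -> : [set z : R * R | z.1 ^+ 2 + z.2 ^+ 2 = 1] =
   `[-1, 1]%classic `*` `[-1, 1]%classic `&`
   [set z : R * R | z.1 ^+ 2 + z.2 ^+ 2 = 1].
  apply/seteqP; split=> -[z1 z2] /=; last by case.
  have b (p q : R) : p ^+ 2 + q ^+ 2 = 1 -> p \in `[-1, 1].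
    move=> e; rewrite in_itv/= -ler_norml -(ler_pXn2r (ltn0Sn 1)) ?nnegrE//.
    by rewrite real_normK ?num_real// expr1n -e lerDl sqr_ge0.
  by move=> e; split=> //; split; [apply: b e|apply: (b _ z1); rewrite addrC].
apply: compact_closedI.
  by apply: compact_setX; exact: segment_compact.
have /continuous_closedP/(_ [set 1]) cl :
    continuous (fun z : R * R => z.1 ^+ 2 + z.2 ^+ 2).
  move=> z; apply: cvgD; apply: cvgM; (exact: cvg_fst || exact: cvg_snd).
by apply: cl; exact: closed_eq.
Qed.

(** A set invariant under a rotation by a small angle and its inverse comes
    close to every point of the circle through each of its points. Among the
    rotations [(C', S')] that keep [x] in [K], take one closest to [(C, S)]:
    no small step in either direction brings it closer, so it is already within
    the order of the step. *)
Lemma rot_approx K a b al be (eps : R) x C S : compact K ->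
  orthonormal2 a b -> refl_stable K a -> refl_stable K (al *: a + be *: b) ->
  al ^+ 2 + be ^+ 2 = 1 -> be != 0 -> be ^+ 2 <= eps ^+ 2 * al ^+ 2 ->
  K x -> C ^+ 2 + S ^+ 2 = 1 ->
  exists C' S', (C' - C) ^+ 2 + (S' - S) ^+ 2 <= 2 * eps ^+ 2 /\
    K (rot a b C' S' x).
Proof.
move=> cK oab Ka Ku e be0 small Kx CS.
pose Z := [set z : R * R | z.1 ^+ 2 + z.2 ^+ 2 = 1] `&`
          [set z : R * R | K (rot a b z.1 z.2 x)].
have c1 : continuous (fun z : R * R => z.1) by move=> z; exact: cvg_fst.
have c2 : continuous (fun z : R * R => z.2) by move=> z; exact: cvg_snd.
have cZ : compact Z.
  apply: compact_closedI circle_compact _.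
  have /continuous_closedP/(_ K) cl :
      continuous (fun z : R * R => rot a b z.1 z.2 x).
    by apply: continuous_rot => // z; exact: cst_continuous.
  by apply: cl; apply: compact_closed cK; exact: norm_hausdorff.
have [[C' S'] /set_mem[/= CS' KCS'] zmax] : exists2 z, z \in Z &
    forall z', z' \in Z -> C * z'.1 + S * z'.2 <= C * z.1 + S * z.2.
  apply: (@compact_EVT_max _ R (fun z => C * z.1 + S * z.2)) => //.
    exists (1, 0); split=> /=; first by ring.
    by rewrite /rot subrr !mul0r subr0 addr0 !scale0r !addr0.
  apply: continuous_subspaceT => z.
  by apply: cvgD; apply: cvgM; (exact: cvg_cst || exact: c1 || exact: c2).
exists C', S'; split=> //.
(* [A] and [B] are the cosine and sine of the remaining angle. *)
set A := C * C' + S * S' in zmax; pose B := C * S' - S * C'.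
have AB : A ^+ 2 + B ^+ 2 = 1.
  transitivity ((C ^+ 2 + S ^+ 2) * (C' ^+ 2 + S' ^+ 2)).
    by rewrite /A /B; ring.
  by rewrite CS CS' mulr1.
have step s : s ^+ 2 = (2 * al * be) ^+ 2 ->
    (forall y, K y -> K (rot a b (al ^+ 2 - be ^+ 2) s y)) ->
    0 <= 2 * be ^+ 2 * A + s * B.
  move=> ss Ks; set c := al ^+ 2 - be ^+ 2 in Ks.
  have cs : c ^+ 2 + s ^+ 2 = 1.
    transitivity ((al ^+ 2 + be ^+ 2) ^+ 2); first by rewrite ss /c; ring.
    by rewrite e expr1n.
  have := zmax (c * C' - s * S', s * C' + c * S'); move=> /(_ _)/=.
  have -> : (c * C' - s * S', s * C' + c * S') \in Z.
    apply/mem_set; split=> /=; last by rewrite -rot_comp//; exact: Ks.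
    transitivity ((c ^+ 2 + s ^+ 2) * (C' ^+ 2 + S' ^+ 2)); first by ring.
    by rewrite cs CS' mulr1.
  move=> /(_ isT).
  have -> : C * (c * C' - s * S') + S * (s * C' + c * S') = c * A - s * B.
    by rewrite /A /B; ring.
  have -> : c = 1 - 2 * be ^+ 2 by move: e; rewrite /c; lra.
  lra.
have p1 : 0 <= 2 * be ^+ 2 * A + 2 * al * be * B.
  by apply: step => // y Ky; rewrite -refl_comp//; exact/Ku/Ka.
have p2 : 0 <= 2 * be ^+ 2 * A + - (2 * al * be) * B.
  by apply: step => [|y Ky]; [rewrite sqrrN|rewrite -refl_compV//; exact/Ka/Ku].
have b2 : 0 < be ^+ 2 by rewrite exprn_even_gt0.
have A0 : 0 <= A by rewrite -(pmulr_rge0 _ b2); lra.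
have e2 : 0 <= eps ^+ 2 := sqr_ge0 _.
have a2 : 0 < al ^+ 2.
  rewrite exprn_even_gt0//=; apply: contraTneq small => ->.
  by rewrite expr0n mulr0 -ltNge.
have BA : B ^+ 2 <= eps ^+ 2 * A ^+ 2.
  have : 0 <= 4 * be ^+ 2 * (be ^+ 2 * A ^+ 2 - al ^+ 2 * B ^+ 2).
    have := mulr_ge0 p1 p2; set X := (X in 0 <= X); set Y := (Y in _ -> 0 <= Y).
    by have -> : X = Y by rewrite /X /Y; ring.
  have b4 : 0 < 4 * be ^+ 2 by rewrite mulr_gt0.
  rewrite (pmulr_rge0 _ b4) subr_ge0 => h.
  rewrite -(ler_pM2l a2); apply: le_trans h _.
  have -> : al ^+ 2 * (eps ^+ 2 * A ^+ 2) = eps ^+ 2 * al ^+ 2 * A ^+ 2 by ring.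
  by rewrite ler_wpM2r ?sqr_ge0.
have A1 : A <= 1.
  rewrite -(ler_pXn2r (ltn0Sn 1)) ?nnegrE// expr1n -AB lerDl; exact: sqr_ge0.
have -> : (C' - C) ^+ 2 + (S' - S) ^+ 2 = 2 * (1 - A).
  transitivity ((C ^+ 2 + S ^+ 2) + (C' ^+ 2 + S' ^+ 2) - 2 * A).
    by rewrite /A; ring.
  by rewrite CS CS'; ring.
rewrite ler_pM2l//.
have : 1 - A <= (1 - A) * (1 + A) by rewrite ler_peMr ?subr_ge0// lerDl.
have -> : (1 - A) * (1 + A) = B ^+ 2.
  transitivity (1 - A ^+ 2); first by ring.
  by rewrite -AB addrC addKr.
move=> h; apply: le_trans h (le_trans BA _).
by rewrite ler_piMr// expr_le1.
Qed.

(** If axes close to [a] span with [a] planes close to the plane of [a] and [b],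
    then [rot_approx] holds in these planes with arbitrarily small error, and
    closedness of [K] passes it to the limit. The exact target [y] is
    [rot a b C S x] for some [C], [S]. *)
Lemma plane_isotropic K a b : compact K -> orthonormal2 a b ->
  refl_stable K a ->
  (forall (eps : R) N, 0 < eps -> nbhs b N -> exists b' al be,
     [/\ N b', orthonormal2 a b', refl_stable K (al *: a + be *: b'),
         al ^+ 2 + be ^+ 2 = 1 & be != 0 /\ be ^+ 2 <= eps ^+ 2 * al ^+ 2]) ->
  isotropic K (<[a]> + <[b]>).
Proof.
move=> cK [a1 b1 ab] Ka near_b x y Kx /memv_addP[_ /vlineP[l ->]].
move=> [_ /vlineP[m ->]] yxE yx.
have {yxE} yE : y = x + l *: a + m *: b by rewrite -addrA -yxE addrC subrK.
set p := dotr x a; set q := dotr x b.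
have pq : (p + l) ^+ 2 + (q + m) ^+ 2 = p ^+ 2 + q ^+ 2.
  move: yx; rewrite yE !dotrE (dotrC a x) (dotrC b x) (dotrC b a) a1 b1 ab.
  by rewrite -/p -/q; lra.
have [C [S [CS pE qE]]] : exists C S, [/\ C ^+ 2 + S ^+ 2 = 1,
    p + l = C * p - S * q & q + m = S * p + C * q].
  have [r0|r0] := eqVneq (p ^+ 2 + q ^+ 2) 0.
    move: (r0) pq => /eqP; rewrite paddr_eq0 ?sqr_ge0// !sqrf_eq0.
    move=> /andP[/eqP -> /eqP ->].
    rewrite expr0n addr0 => /eqP; rewrite paddr_eq0 ?sqr_ge0// !sqrf_eq0.
    by move=> /andP[/eqP -> /eqP ->]; exists 1, 0; split; ring.
  exists ((p * (p + l) + q * (q + m)) / (p ^+ 2 + q ^+ 2)),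
         ((p * (q + m) - q * (p + l)) / (p ^+ 2 + q ^+ 2)).
  split; [|by field|by field].
  rewrite !expr_div_n -mulrDl; set D := p ^+ 2 + q ^+ 2 in r0 *.
  rewrite [X in X / _](_ : _ = D * ((p + l) ^+ 2 + (q + m) ^+ 2)).
    2: by rewrite /D; ring.
  by rewrite pq -expr2 divff// expf_neq0.
have {yE} yE : y = rot a b C S x.
  rewrite yE /rot -/p -/q.
  have -> : l = (C - 1) * p - S * q by lra.
  by have -> : m = S * p + (C - 1) * q by lra.
pose F (z : 'rV[R]_d * R * R) := rot a z.1.1 z.1.2 z.2 x.
have cl : closed (F @^-1` K).
  have /continuous_closedP/(_ K) cl : continuous F.
    apply: continuous_rot => z; last exact: cvg_snd.
    - by apply: continuous_comp; [exact: cvg_fst|exact: cvg_fst].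
    - by apply: continuous_comp; [exact: cvg_fst|exact: cvg_snd].
  by apply: cl; apply: compact_closed cK; exact: norm_hausdorff.
rewrite yE; apply: (cl (b, C, S)).
move=> B [[P Q] /= [[[P1 P2] /= [bP1 CP2] P12] SQ] PQ].
have /nbhs_ballP[e1 /= e1_gt0 e1P] := CP2.
have /nbhs_ballP[e2 /= e2_gt0 e2Q] := SQ.
pose eps := Num.min e1 e2 / 2.
have m0 : 0 < Num.min e1 e2 by rewrite lt_min e1_gt0.
have eps0 : 0 < eps by rewrite divr_gt0.
have [b' [al [be [bP ob' Ku e [be0 small]]]]] := near_b eps P1 eps0 bP1.
have [C' [S' [CS' KCS']]] := rot_approx cK ob' Ka Ku e be0 small Kx CS.
have close t : t ^+ 2 <= 2 * eps ^+ 2 -> `|t| < Num.min e1 e2.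
  move=> tt; rewrite -(ltr_pXn2r (ltn0Sn 1)) ?nnegrE ?(ltW m0)//.
  rewrite real_normK ?num_real//; apply: le_lt_trans tt _.
  have -> : Num.min e1 e2 ^+ 2 = 4 * eps ^+ 2 by rewrite /eps; field.
  by rewrite ltr_pM2r ?exprn_gt0// ltr_nat.
have C'P : P2 C'.
  apply: e1P; rewrite /ball/= distrC; apply: lt_le_trans (close _ _) _.
    by apply: le_trans CS'; rewrite lerDl sqr_ge0.
  by rewrite ge_min lexx.
have S'Q : Q S'.
  apply: e2Q; rewrite /ball/= distrC; apply: lt_le_trans (close _ _) _.
    by apply: le_trans CS'; rewrite lerDr sqr_ge0.
  by rewrite ge_min lexx orbT.
by exists (b', C', S'); split=> //; apply: PQ; split=> //=; exact: P12.
Qed.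

Lemma continuous_refl (T : topologicalType) (f : T -> 'rV[R]_d) x :
  continuous f -> continuous (fun t => refl (f t) x).
Proof.
move=> cf; have cx : continuous (fun t => dotr x (f t)).
  by apply: continuous_dotr => // t; exact: cst_continuous.
move=> t; apply: cvgB; last exact: cvg_cst.
by apply: cvgZ; [apply: cvgM; [exact: cvg_cst|exact: cx]|exact: cf].
Qed.

Lemma closed_refl_stable K x : compact K -> closed [set v | K (refl v x)].
Proof.
move=> cK.
have /continuous_closedP/(_ K) cl : continuous (fun v : 'rV[R]_d => refl v x).
  by apply: continuous_refl => v; exact: cvg_id.
by apply: cl; apply: compact_closed cK; exact: norm_hausdorff.
Qed.

(** Infinitely many unit vectors accumulate at some [a], whose axial symmetry
    preserves [K] because [K] is closed. A vector [al *: a + be *: b'] of the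
    family near [a] but different from [a] and [- a] has [be] small and nonzero;
    the directions [b'] accumulate in turn, at the required [b]. The last
    conjunct is how the fact that [a] is a limit of the [u n] is used. *)
Lemma exists_isotropic_plane K (u : nat -> 'rV[R]_d) : compact K ->
  (forall n, dotr (u n) (u n) = 1) -> (forall n, refl_stable K (u n)) ->
  infinite_set (range u) ->
  exists a b, [/\ orthonormal2 a b, isotropic K (<[a]> + <[b]>) &
    forall w, (forall n, dotr (u n) w = 0) -> dotr a w = 0].
Proof.
move=> cK u1 Ku /infiniteP/pcard_leP/injfunPex[/= v v_u v_inj].
have {}v_u n : exists m, v n = u m by have [m _ <-] := v_u n Logic.I; exists m.
have {}v_inj m n : v m = v n -> m = n by apply: v_inj; rewrite in_setT.
have v1 n : dotr (v n) (v n) = 1 by have [m ->] := v_u n.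
have Kv n : refl_stable K (v n) by have [m ->] := v_u n.
have [a a1 cla] := unit_seq_cluster v1.
have Ka : refl_stable K a.
  move=> x Kx.
  have := @cluster_closed R d v a [set w | K (refl w x)] cla.
  by apply; [exact: closed_refl_stable|move=> n; exact: Kv].
have avoid p : exists M, forall n, (M <= n)%N -> v n != p.
  have [[m <-]|nex] := pselect (exists m, v m = p).
    by exists m.+1 => n mn; apply: contraTneq mn => /v_inj ->; rewrite ltnn.
  by exists 0%N => n _; apply: contra_notN nex => /eqP <-; exists n.
have near_a (j : nat) : exists t : 'rV[R]_d * R * R,
    [/\ orthonormal2 a t.1.1, refl_stable K (t.1.2 *: a + t.2 *: t.1.1),
       t.1.2 ^+ 2 + t.2 ^+ 2 = 1 &
       t.2 != 0 /\ t.2 ^+ 2 <= (j.+1%:R^-1) ^+ 2 * t.1.2 ^+ 2].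
  have [M1 av1] := avoid a; have [M2 av2] := avoid (- a).
  pose e : R := (j.+1%:R^-1) ^+ 2.
  have e0 : 0 < e by rewrite exprn_gt0// invr_gt0 ltr0n.
  pose B := [set w : 'rV[R]_d | 1 < dotr w a ^+ 2 * (1 + e)].
  have aB : nbhs a B.
    have cB : continuous (fun w : 'rV[R]_d => dotr w a ^+ 2 * (1 + e)).
      have ca : continuous (fun w : 'rV[R]_d => dotr w a).
        by apply: continuous_dotr => w; [exact: cvg_id|exact: cst_continuous].
      move=> w; have c2 := @continuousM _ _ _ _ w (ca w) (ca w).
      exact: (@continuousM _ _ _ _ w c2 (@cst_continuous _ _ (1 + e) w)).
    apply: (cB a [set r | 1 < r]); apply: lt_nbhsr.
    by rewrite a1 expr1n mul1r ltrDl.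
  have [n + /= Bn] := cla B (maxn M1 M2) aB.
  rewrite geq_max => /andP[n1 n2].
  set al := dotr (v n) a in Bn; pose w := v n - al *: a.
  have aw : dotr a w = 0 by rewrite /w !dotrE a1 (dotrC a) -/al; ring.
  have vE : v n = al *: a + w by rewrite /w addrC subrK.
  have w0 : w != 0.
    apply/eqP => w0; move: (v1 n); rewrite vE w0 addr0 !dotrE a1 mulr1 -expr2.
    move/eqP; rewrite sqrf_eq1 => /orP[]/eqP al1.
      by move: (av1 _ n1); rewrite vE w0 al1 addr0 scale1r eqxx.
    by move: (av2 _ n2); rewrite vE w0 al1 addr0 scaleN1r eqxx.
  have [be [b' [be0 b'1 wE]]] := unit_direction w0.
  have ab' : dotr a b' = 0.
    by move/eqP: aw; rewrite wE dotrZr mulf_eq0 gt_eqF//= => /eqP.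
  have albe : al ^+ 2 + be ^+ 2 = 1.
    by rewrite -(v1 n) vE wE !dotrE a1 b'1 (dotrC b') ab'; ring.
  exists (b', al, be); split => //=; first by rewrite -wE -vE; exact: Kv.
  rewrite gt_eqF//; split=> //; rewrite -/e; move: albe.
  by have : 1 < al ^+ 2 * (1 + e) := Bn; lra.
have [t tP] := choice near_a.
have b1 j : dotr (t j).1.1 (t j).1.1 = 1 by have [[]] := tP j.
have [b b_unit clb] := unit_seq_cluster b1.
have ab : dotr a b = 0.
  rewrite dotrC; have := @cluster_closed R d _ b [set v | dotr v a = 0] clb.
  apply; [exact: closed_orthogonal|move=> j /=].
  by rewrite dotrC; have [[]] := tP j.
exists a, b; split=> //; last first.
  move=> w uw; have := @cluster_closed R d _ a [set v | dotr v w = 0] cla.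
  apply; [exact: closed_orthogonal|move=> n /=].
  by have [m ->] := v_u n.
apply: plane_isotropic => // eps N eps0 bN.
have [J Jeps] : exists J : nat, eps^-1 < J%:R.
  by exists (Num.truncn eps^-1).+1; rewrite truncnS_gt.
have [j Jj Nj] := clb _ J bN.
exists (t j).1.1, (t j).1.2, (t j).2; have [? ? ? [? le]] := tP j; split=> //.
split=> //; apply: le_trans le _; rewrite ler_wpM2r ?sqr_ge0//.
rewrite ler_pXn2r ?nnegrE ?invr_ge0 ?ler0n ?ltW//.
rewrite invf_plt ?posrE ?ltr0n//; apply: lt_le_trans Jeps _.
by rewrite ler_nat leqW.
Qed.

Lemma dim_plane a b : orthonormal2 a b -> \dim (<[a]> + <[b]>) = 2%N.
Proof.
case=> a1 b1 ab.
rewrite dimv_disjoint_sum ?dim_vline ?unit_neq0//.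
apply/eqP; rewrite -subv0; apply/subvP => x; rewrite memv_cap memv0.
move=> /andP[/vlineP[l ->] /vlineP[m e]].
have := congr1 (dotr a) e; rewrite !dotrZr a1 ab mulr0 mulr1 => ->.
by rewrite scale0r.
Qed.

(** Take [W] of maximal dimension among the subspaces containing [a] along which
    [K] is isotropic. By [isotropic_add_line] each [u n] is in [W] or orthogonal
    to it. As no two of them are orthogonal, they are all in [W] or all
    orthogonal to [W]; the latter would make their limit [a] orthogonal to
    itself. *)
Lemma isotropic_span K (u : nat -> 'rV[R]_d) : compact K ->
  (forall n, dotr (u n) (u n) = 1) -> (forall n, refl_stable K (u n)) ->
  infinite_set (range u) -> (forall i j, i <> j -> dotr (u i) (u j) != 0) ->
  exists2 W, isotropic K W & forall n, u n \in W.
Proof.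
move=> cK u1 Ku infu uu.
have [a [b [oab isoab a_lim]]] := exists_isotropic_plane cK u1 Ku infu.
pose P n := `[< exists W, [/\ isotropic K W, a \in W, (2 <= \dim W)%N
                             & \dim W = n] >].
have exP : exists n, P n.
  exists 2%N; apply/asboolP; exists (<[a]> + <[b]>)%VS; rewrite dim_plane//.
  by split=> //; apply: subvP (addvSl _ _) _ (memv_line _).
have ubP n : P n -> (n <= d)%N.
  move=> /asboolP[W [_ _ _ <-]].
  by have := dimvS (subvf W); rewrite dimvf /dim/= mul1n.
case: (ex_maxnP exP ubP) => n /asboolP[W [isoW aW dW dWn]] max_n.
have in_or_perp m : u m \notin W -> forall w, w \in W -> dotr (u m) w = 0.
  move=> umW w wW; apply/eqP; apply: contraT => umw.
  have isoWu : isotropic K (W + <[u m]>).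
    by apply: isotropic_add_line => //; exists w.
  have lt : (n < \dim (W + <[u m]>))%N.
    rewrite -dWn ltnNge; apply: contra umW => le.
    have /eqP -> : W == (W + <[u m]>)%VS by rewrite eqEdim addvSl.
    by apply: subvP (addvSr _ _) _ (memv_line _).
  have /max_n : P (\dim (W + <[u m]>)); last by rewrite leqNgt lt.
  apply/asboolP; exists (W + <[u m]>)%VS; split=> //.
    exact: subvP (addvSl _ _) _ aW.
  exact: leq_trans dW (dimvS (addvSl _ _)).
have [allW|] := pselect (forall m, u m \in W); first by exists W.
move=> /existsNP[m /negP umW].
suff : dotr a a = 0 by case: oab => -> _ _ /eqP; rewrite oner_eq0.
apply: a_lim => i; apply: (in_or_perp) => //.
have [->//|/eqP im] := eqVneq i m.
apply: contraNN (uu _ _ (not_eq_sym im)) => uiW.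
by apply/eqP; exact: in_or_perp.
Qed.
End Plane.

(** * The centre of the body and the shape of its sections *)

Section Geometry.
Variables (R : realType) (d : nat).
Implicit Types (c p q u v w x y z : 'rV[R]_d) (V W : {vspace 'rV[R]_d}).
Implicit Types (K L : set 'rV[R]_d).

Lemma convex_setP K x y (t : R) : convex_set K -> K x -> K y ->
  0 <= t -> t <= 1 -> K (t *: x + (1 - t) *: y).
Proof.
move=> cK Kx Ky t0 t1.
by apply/set_mem; apply: (cK x y (Itv01 t0 t1)); exact/mem_set.
Qed.

Lemma continuous_enorm (T : topologicalType) (f : T -> 'rV[R]_d) :
  continuous f -> continuous (fun t => enorm (f t)).
Proof.
move=> cf t.
apply: (@continuous_comp _ _ _ (fun t => dotr (f t) (f t)) Num.sqrt).
  exact: continuous_dotr.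
exact: sqrt_continuous.
Qed.

(** The centre [c] in [K] of a smallest ball containing [K] is unique, by the
    parallelogram identity at the midpoint of two such centres; hence isometries
    that preserve [K] fix it. It exists because the distance from [c] to the
    farthest point [far c] of [K] is a Lipschitz function of [c]. *)
Lemma circumcenter K : compact K -> convex_set K -> K !=set0 ->
  exists2 c, K c & forall s : 'rV[R]_d -> 'rV[R]_d, s @` K = K ->
    (forall x y, enorm (s x - s y) = enorm (x - y)) -> s c = c.
Proof.
move=> cK convK K0.
have /choice[far farP] c :
    exists x, K x /\ forall y, K y -> enorm (y - c) <= enorm (x - c).
  have [x /set_mem Kx xmax] : exists2 x, x \in K &
      forall y, y \in K -> enorm (y - c) <= enorm (x - c).
    apply: (@compact_EVT_max _ R (fun x => enorm (x - c))) => //.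
    apply: continuous_subspaceT; apply: continuous_enorm => x.
    by apply: continuousB; [exact: cvg_id|exact: cst_continuous].
  by exists x; split=> // y /mem_set; exact: xmax.
pose F c := enorm (far c - c).
have FP c y : K y -> enorm (y - c) <= F c by have [_ +] := farP c; apply.
have F_lip c c' : F c' <= F c + enorm (c - c').
  have [Kf _] := farP c'; rewrite {1}/F.
  have -> : far c' - c' = (far c' - c) + (c - c') by rewrite addrA subrK.
  by apply: le_trans (enormD _ _) _; rewrite lerD2r FP.
have cF : continuous F.
  move=> c; apply/(@cvgrPdist_lt _ _ _ (nbhs c)) => e e0.
  have ce : continuous (fun c' => enorm (c - c')).
    apply: continuous_enorm => x.
    by apply: continuousB; [exact: cst_continuous|exact: cvg_id].
  have : nbhs c [set c' | enorm (c - c') < e].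
    apply: (ce c [set r | r < e]); apply: lt_nbhsl.
    by rewrite subrr /enorm dotr0 sqrtr0.
  apply: filterS => c' /= lt; apply: le_lt_trans lt.
  have := F_lip c c'; have := F_lip c' c; rewrite -(enormN (c' - c)) opprB.
  by rewrite ler_norml; lra.
have [c /set_mem Kc cmin] :
    exists2 c, c \in K & forall c', c' \in K -> F c <= F c'.
  by apply: (@compact_EVT_min _ R F) => //; exact: continuous_subspaceT.
exists c => // s sK s_iso.
have Ksc : K (s c) by rewrite -sK; exists c.
have Fs z : K z -> enorm (z - s c) <= F c.
  by rewrite -{1}sK => -[y Ky <-]; rewrite s_iso; exact: FP.
pose m := (2^-1 : R) *: c + (1 - 2^-1) *: s c.
have Km : K m by apply: convex_setP => //; lra.
have [Kz _] := farP m; set z := far m in Kz.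
have F0 : 0 <= F c by exact: enorm_ge0.
have z1 := FP c z Kz; have z2 := Fs z Kz.
have z3 : F c <= enorm (z - m) by apply: cmin; exact/mem_set.
have {z1}z1 : dotr (z - c) (z - c) <= F c ^+ 2 by rewrite -enorm_le.
have {z2}z2 : dotr (z - s c) (z - s c) <= F c ^+ 2 by rewrite -enorm_le.
have {z3}z3 : F c ^+ 2 <= dotr (z - m) (z - m).
  by rewrite -sqr_enorm ler_pXn2r ?nnegrE ?enorm_ge0.
have par : 4 * dotr (z - m) (z - m) = 2 * dotr (z - c) (z - c)
    + 2 * dotr (z - s c) (z - s c) - dotr (s c - c) (s c - c).
  by rewrite /m !dotrE (dotrC c z) (dotrC (s c) z) (dotrC c (s c)); field.
have : dotr (s c - c) (s c - c) = 0.
  by apply/eqP; rewrite eq_le dotr_ge0 andbT; lra.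
by move/dotr_eq0/eqP; rewrite subr_eq0 => /eqP.
Qed.

Lemma line_direction L : is_flat 1 L ->
  exists p u, dotr u u = 1 /\ L = flat p <[u]>.
Proof.
move=> [p [V [dV ->]]].
have V0 : V != 0%VS by rewrite -dimv_eq0 dV.
have := V0; rewrite -vpick0 => v0.
have [a [u [a0 u1 vE]]] := unit_direction v0.
exists p, u; split=> //; congr flat; apply/eqP.
rewrite eq_sym eqEdim dV dim_vline (unit_neq0 u1) andbT -memvE.
have -> : u = a^-1 *: vpick V by rewrite vE scalerA mulVf ?scale1r// gt_eqF.
by rewrite memvZ// memv_pick.
Qed.

Lemma axial_symmetry_refl p u x : dotr u u = 1 ->
  axial_symmetry (flat p <[u]>) x = p + refl u (x - p).
Proof.
move=> u1; set a := dotr (x - p) u.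
have {1}-> : x = (p + a *: u) + (x - p - a *: u).
  by rewrite -(addrA x) -opprD [RHS]addrC subrK.
rewrite axial_symmetryE; last first.
- move=> _ _ -> [_ [y /= yu <-] [_ [z /= zu <-] <-]].
  have : y - z \in <[u]>%VS by rewrite memvB.
  move=> /vlineP[b yz].
  rewrite (addrC p y) addrKA yz dotrZr dotrDl dotrNl dotrZl.
  by rewrite u1 mulr1 subrr mulr0.
- by exists (a *: u) => //=; rewrite memvZ// memv_line.
rewrite /refl -/a; rowring.
Qed.

Lemma refl_fixed u x : refl u x = x -> x \in <[u]>%VS.
Proof.
move=> e; apply/vlineP; exists (dotr x u); apply/rowP => i.
by have /rowP/(_ i) := e; rewrite !mxE; lra.
Qed.

(** Let [r] be the largest distance to [w] in the section. Isotropy puts the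
    whole sphere of radius [r] about [w] in [K], convexity then its centre, as a
    midpoint, and the segments from the centre. *)
Lemma isotropic_section K V w : compact K -> convex_set K -> isotropic K V ->
  w \in orthv V -> (exists2 x, K x & x - w \in V) ->
  exists2 r : R, 0 <= r & forall y, y - w \in V -> (K y <-> enorm (y - w) <= r).
Proof.
move=> cK convK isoV /orthvP wV [x0 Kx0 x0V].
have [x /set_mem[Kx xV] xmax] : exists2 x, x \in K `&` [set x | x - w \in V] &
    forall y, y \in K `&` [set x | x - w \in V] ->
      enorm (y - w) <= enorm (x - w).
  apply: (@compact_EVT_max _ R (fun x => enorm (x - w))).
  - by exists x0.
  - by apply: compact_closedI => //; exact: closed_flat.
  apply: continuous_subspaceT; apply: continuous_enorm => y.
  by apply: continuousB; [exact: cvg_id|exact: cst_continuous].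
set r := enorm (x - w) in xmax.
have r0 : 0 <= r := enorm_ge0 _.
have norm v : v \in V -> dotr (w + v) (w + v) = dotr w w + dotr v v.
  by move=> vV; rewrite !dotrE (dotrC v w) (wV v)//; ring.
have sphere v : v \in V -> dotr v v = r ^+ 2 -> K (w + v).
  move=> vV vr; apply: (isoV x) => //.
    have -> : w + v - x = v - (x - w) by rewrite opprB addrA addrAC addrC addrA.
    by rewrite memvB.
  rewrite -[in RHS](subrK w x) [x - w + w]addrC !norm// vr; congr (_ + _).
  exact: sqr_enorm.
have Kw : K w.
  have -> : w = 2^-1 *: (w + (x - w)) + (1 - 2^-1) *: (w - (x - w)).
    by apply/rowP => i; rewrite !mxE; field.
  apply: convex_setP => //; try lra; apply: sphere; rewrite ?memvN//.
    by rewrite -sqr_enorm.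
  by rewrite dotrNl dotrNr opprK -sqr_enorm.
exists r => // y yV; split=> [Ky|yr]; first by apply: xmax; exact/mem_set.
have [e|ne] := eqVneq (y - w) 0.
  by have -> : y = w by apply/eqP; rewrite -subr_eq0 e.
have [a [f [a0 f1 yE]]] := unit_direction ne.
have ar : a <= r.
  move: yr; rewrite yE enorm_le// !dotrE f1 mulr1 -expr2.
  by rewrite ler_pXn2r ?nnegrE// ltW.
have rgt0 : 0 < r by exact: lt_le_trans ar.
have fV : f \in V.
  have -> : f = a^-1 *: (y - w) by rewrite yE scalerA mulVf ?scale1r// gt_eqF.
  by rewrite memvZ.
have -> : y = (a / r) *: (w + r *: f) + (1 - a / r) *: w.
  have -> : y = w + a *: f by rewrite -yE addrC subrK.
  by apply/rowP => i; rewrite !mxE; field; rewrite gt_eqF.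
apply: convex_setP => //.
- by apply: sphere; rewrite ?memvZ// !dotrE f1; ring.
- by rewrite divr_ge0// ltW.
- by rewrite ler_pdivrMr// mul1r.
Qed.
End Geometry.

Section ConvexBody.
Variables (R : realType) (d : nat).
Implicit Types (c p q u v w x y z : 'rV[R]_d) (V W : {vspace 'rV[R]_d}).
Implicit Types (K L : set 'rV[R]_d).

Lemma flatP p V x : flat p V x <-> x - p \in V.
Proof.
split=> [[v /= vV <-]|xV]; first by rewrite addrC addKr.
by exists (x - p) => //; rewrite addrC subrK.
Qed.

Lemma flat_rebase p c V : c - p \in V -> flat p V = flat c V.
Proof.
move=> cV; apply/seteqP; split=> x /flatP xV; apply/flatP.
  have -> : x - c = (x - p) - (c - p) by rewrite opprB addrA subrK.
  by rewrite memvB.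
have -> : x - p = (x - c) + (c - p) by rewrite addrA subrK.
by rewrite memvD.
Qed.

(** The centre of [circumcenter] is fixed by every axial symmetry preserving
    [K], and the fixed points of an axial symmetry are the points of its axis. *)
Lemma axes_concurrent K : compact K -> convex_set K -> K !=set0 ->
  exists2 c, K c & forall L, axis_of_symmetry K L -> exists2 u,
    dotr u u = 1 & L = flat c <[u]> /\
      refl_stable [set x | K (c + x)] u.
Proof.
move=> cK convK K0; have [c Kc c_fix] := circumcenter cK convK K0.
exists c => // L [fL symL].
have [p [u [u1 LE]]] := line_direction fL.
have sE x : axial_symmetry L x = p + refl u (x - p).
  by rewrite LE axial_symmetry_refl.
have cL : c - p \in <[u]>%VS.
  apply: refl_fixed; have := c_fix _ symL; rewrite sE => cfix.
  rewrite -{2}cfix; first by rewrite addrAC subrr add0r.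
  move=> x y; rewrite !sE /enorm; congr Num.sqrt.
  have -> : p + refl u (x - p) - (p + refl u (y - p)) = refl u (x - y).
    rewrite /refl; have -> : dotr (x - y) u = dotr (x - p) u - dotr (y - p) u.
      by rewrite !dotrE; ring.
    by rowring.
  by rewrite dotr_refl.
exists u => //; rewrite LE -(flat_rebase cL); split=> // x /= Kx.
have : K (axial_symmetry (flat c <[u]>) (c + x)).
  by rewrite -(flat_rebase cL) -LE -[X in X _]symL; exists (c + x).
by rewrite axial_symmetry_refl// (addrC c x) addrK.
Qed.

Lemma compact_translate K c : compact K -> compact [set x | K (c + x)].
Proof.
move=> cK; have -> : [set x | K (c + x)] = (fun x => x - c) @` K.
  apply/seteqP; split=> [x /= Kx|_ [y Ky <-] /=].
    by exists (c + x) => //; rewrite addrC addKr.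
  by rewrite addrC subrK.
apply: continuous_compact cK; apply: continuous_subspaceT => x.
by apply: continuousB; [exact: cvg_id|exact: cst_continuous].
Qed.

Lemma convex_translate K c : convex_set K -> convex_set [set x | K (c + x)].
Proof.
move=> cK x y l /set_mem/= Kx /set_mem/= Ky; apply/mem_set => /=.
have convE (a b : 'rV[R]_d) : conv l (a : convex_lmodType _) b =
  l%:num *: a + (1 - l%:num) *: b by [].
have := cK _ _ l (mem_set Kx) (mem_set Ky) => /set_mem; congr K.
rewrite !convE; rowring.
Qed.

Lemma isotropic_flat_section K c V w : compact K -> convex_set K ->
  isotropic [set x | K (c + x)] V -> w \in orthv V ->
  flat (c + w) V `&` K !=set0 ->
  exists2 r : R, 0 <= r &
    K `&` flat (c + w) V = closed_eball (c + w) r `&` flat (c + w) V.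
Proof.
move=> cK convK isoV wV [x [/flatP xV Kx]].
have [|r r0 rP] := isotropic_section (compact_translate (c := c) cK)
    (convex_translate (c := c) convK) isoV wV.
  by exists (x - c); [rewrite /= addrC subrK|rewrite -addrA -opprD].
exists r => //; apply/seteqP; split=> y [Hy yV]; split=> //;
  move: (rP (y - c)); rewrite /= (addrC c) subrK -addrA -opprD => rPy;
  by apply/rPy => //; exact/flatP.
Qed.

Lemma isotropic_body_of_revolution K c k V : compact K -> convex_set K ->
  isotropic [set x | K (c + x)] V -> \dim V = k -> body_of_revolution k K.
Proof.
move=> cK convK isoV dV.
exists V, (flat c (orthv V)); split=> //.
- by exists c, (orthv V); rewrite dim_orthv dV.
- move=> _ v [_ [x /= xV <-] [_ [y /= yV <-] <-]] /= vV.
  have : x - y \in orthv V by rewrite memvB.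
  by rewrite (addrC c x) addrKA => /orthvP ->.
move=> p pK.
have [v [w [vV wV pE]]] := orthv_decomposition V (p - c).
have pcw : (c + w) - p \in V.
  have -> : c + w - p = - v.
    transitivity (w - (p - c)); first by rowring.
    by rewrite pE opprD addrCA subrr addr0.
  by rewrite memvN.
rewrite (flat_rebase pcw) in pK *.
have [r r0 rE] := isotropic_flat_section cK convK isoV wV pK.
exists (c + w), r; split=> //.
apply/seteqP; split=> [x [/flatP xV /flatP xO]|_ ->] /=.
  have : x - (c + w) \in (V :&: orthv V)%VS.
    by rewrite memv_cap xV /= opprD addrA memvB.
  by rewrite orthv_cap memv0 subr_eq0 => /eqP.
by split; apply/flatP; rewrite ?subrr ?mem0v// addrC addKr.
Qed.

Lemma isotropic_sphere K c : convex_body K -> K c -> (0 < d)%N ->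
  isotropic [set x | K (c + x)] fullv -> is_sphere K.
Proof.
case=> cK convK intK Kc d0 iso.
have [|r r0] := isotropic_flat_section (w := 0) cK convK iso (mem0v _).
  by exists c; split=> //; apply/flatP; exact: memvf.
have -> : flat (c + 0) fullv = setT.
  by apply/seteqP; split=> x // _; apply/flatP; exact: memvf.
rewrite !setIT addr0 => KE; exists c, r; split=> //.
rewrite lt_neqAle r0 andbT; apply/eqP => r_eq0.
have K1 : K = [set c].
  rewrite KE; apply/seteqP; split=> [x|_ ->].
    rewrite /closed_eball/= enorm_le// -r_eq0 expr0n => le.
    apply/eqP; rewrite -subr_eq0; apply/eqP/dotr_eq0/eqP.
    by rewrite eq_le le dotr_ge0.
  by rewrite /closed_eball/= subrr enorm_le// dotr0 sqr_ge0.
case: intK => x; rewrite K1 => xint.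
have cx : c = x by have := interior_subset xint.
have /nbhs_ballP[e /= e0 eK] := xint.
(* A one-point set has no interior: the ball around its point contains a point
   shifted in every coordinate. *)
pose y : 'rV[R]_d := \row_i (x 0 i + e / 2).
have /eK /= : ball x e y.
  split=> // i j; rewrite /ball/= ord1 mxE opprD addNKr normrN.
  by rewrite gtr0_norm ?divr_gt0// ltr_pdivrMr// ltr_pMr// ltr1n.
rewrite cx => /rowP/(_ (Ordinal d0)); rewrite mxE => /eqP.
by rewrite -subr_eq0 addrAC subrr add0r gt_eqF// divr_gt0.
Qed.
End ConvexBody.

Theorem theorem3 (R : realType) (d k : nat) (K : set 'rV[R]_d)
    (L : nat -> set 'rV[R]_d)
    (hd : (3 <= d)%N) (hK : convex_body K) (hk : (2 <= k <= d)%N)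
    (hL : forall n, axis_of_symmetry K (L n))
    (hinf : infinite_set (range L))
    (hhull : is_flat k (affine_hull (\bigcup_n L n)))
    (hperp : forall i j, i <> j -> ~ perpendicular (L i) (L j)) :
  ((k <= d - 1)%N -> body_of_revolution k K) /\ (k = d -> is_sphere K).
Proof.
case: hK => cK convK intK.
have K0 : K !=set0 by case: intK => x /interior_subset; exists x.
have [c Kc axes] := axes_concurrent cK convK K0.
have /choice[u uP] n : exists u, [/\ dotr u u = 1, L n = flat c <[u]> &
    refl_stable [set x | K (c + x)] u].
  by have [u u1 [LE Ku]] := axes _ (hL n); exists u.
have [W isoW uW] :
    exists2 W, isotropic [set x | K (c + x)] W & forall n, u n \in W.
  apply: isotropic_span.
  - exact: compact_translate.
  - by move=> n; case: (uP n).
  - by move=> n; case: (uP n).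
  - apply: contra_not hinf => fin.
    have -> : range L = (fun v => flat c <[v]>) @` range u.
      apply/seteqP; split=> [_ [n _ <-]|_ [_ [n _ <-] <-]].
        by exists (u n); [exists n|case: (uP n)].
      by exists n => //; case: (uP n).
    exact: finite_image.
  - move=> i j ij; apply: contra_notN (hperp _ _ ij) => /eqP uij.
    have line n v : directions (L n) v -> exists l, v = l *: u n.
      have [_ -> _] := uP n => -[x /flatP xn [y /flatP yn <-]].
      apply/vlineP; have -> : x - y = (x - c) - (y - c).
        by rewrite opprB addrA subrK.
      by rewrite memvB.
    move=> _ _ /line[a ->] /line[b ->].
    by rewrite dotrZl dotrZr uij !mulr0.
(* The flat [flat c W] contains all the axes, hence their affine hull. *)
have [p [V [dV hullE]]] := hhull.
have VW : (V <= W)%VS.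
  have hullW : affine_hull (\bigcup_n L n) `<=` flat c W.
    apply: smallest_sub; first by exists (\dim W), c, W.
    move=> x [n _]; have [_ -> _] := uP n => /flatP xu; apply/flatP.
    by apply: subvP xu; rewrite -memvE.
  apply/subvP => v vV.
  have /hullW/flatP pW : affine_hull (\bigcup_n L n) p.
    by rewrite hullE; apply/flatP; rewrite subrr mem0v.
  have /hullW/flatP pvW : affine_hull (\bigcup_n L n) (p + v).
    by rewrite hullE; apply/flatP; rewrite addrC addKr.
  have -> : v = (p + v - c) - (p - c) by rewrite opprB addrA subrK addrC addKr.
  by rewrite memvB.
have isoV : isotropic [set x | K (c + x)] V.
  by move=> x y Kx xy; apply: isoW Kx _; exact: subvP VW _ xy.
split=> [_|kd]; first exact: isotropic_body_of_revolution isoV dV.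
apply: (isotropic_sphere (c := c)) => //; first exact: ltn_trans hd.
suff <- : V = fullv by [].
by apply/eqP; rewrite eqEdim subvf/= dV kd dimvf /dim/= mul1n.
Qed.
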